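(* Let $\alpha$ be a nonzero rational number with $\alpha\notin\{+1,-1\}$. Then $\log_{\mathcal{A}}(\alpha)\in\mathcal{A}\setminus\mathbb{Q}^\times$; that is, $\log_{\mathcal{A}}(\alpha)$ is not equal (in $\mathcal{A}$) to any nonzero rational number.
   Context: $\mathcal{A}\coloneqq\bigl(\prod_{p}\mathbb{Z}/p\mathbb{Z}\bigr)/\bigl(\bigoplus_{p}\mathbb{Z}/p\mathbb{Z}\bigr)$ over all primes $p$; elements are written $(a_p)_p$, equal iff components agree for all but finitely many primes; $\mathbb{Q}$ embeds diagonally via $r\mapsto(r\bmod p)_p$. For a prime $p$ and $\alpha\in\mathbb{Z}_{(p)}^\times$ (localization of $\mathbb{Z}$ at $(p)$), the Fermat quotient is $q_p(\alpha)\coloneqq(\alpha^{p-1}-1)/p\in\mathbb{Z}_{(p)}$, and $\log_{\mathcal{A}}(\alpha)\coloneqq(q_p(\alpha)\bmod p)_p$ for $\alpha\in\mathbb{Q}^\times$ (defined for all primes with $\alpha\in\mathbb{Z}_{(p)}^\times$). *)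

(* Defs.v *)
From HB Require Import structures.
From mathcomp Require Import all_boot all_order all_algebra.
From mathcomp Require Import boolp classical_sets functions cardinality.

Set Implicit Arguments.
Unset Strict Implicit.
Unset Printing Implicit Defensive.

Import Order.TTheory GRing.Theory Num.Theory.

Local Open Scope classical_set_scope.
Local Open Scope ring_scope.

Definition primeT : Type := {p : nat | prime p}.
HB.instance Definition _ := Countable.on primeT.

Definition prodFp : Type := forall p : primeT, 'F_(val p).
HB.instance Definition _ := Choice.on prodFp.

Section ProdFpRing.

Implicit Types x y z : prodFp.

Definition prodFp_zero : prodFp := fun _ => 0.
Definition prodFp_one : prodFp := fun _ => 1.
Definition prodFp_opp x : prodFp := fun p => - x p.
Definition prodFp_add x y : prodFp := fun p => x p + y p.
Definition prodFp_mul x y : prodFp := fun p => x p * y p.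

Fact prodFp_addA : associative prodFp_add.
Proof. by move=> x y z; apply: functional_extensionality_dep => p; exact: addrA. Qed.
Fact prodFp_addC : commutative prodFp_add.
Proof. by move=> x y; apply: functional_extensionality_dep => p; exact: addrC. Qed.
Fact prodFp_add0 : left_id prodFp_zero prodFp_add.
Proof. by move=> x; apply: functional_extensionality_dep => p; exact: add0r. Qed.
Fact prodFp_addN : left_inverse prodFp_zero prodFp_opp prodFp_add.
Proof. by move=> x; apply: functional_extensionality_dep => p; exact: addNr. Qed.
Fact prodFp_mulA : associative prodFp_mul.
Proof. by move=> x y z; apply: functional_extensionality_dep => p; exact: mulrA. Qed.
Fact prodFp_mulC : commutative prodFp_mul.
Proof. by move=> x y; apply: functional_extensionality_dep => p; exact: mulrC. Qed.
Fact prodFp_mul1 : left_id prodFp_one prodFp_mul.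
Proof. by move=> x; apply: functional_extensionality_dep => p; exact: mul1r. Qed.
Fact prodFp_mulDl : left_distributive prodFp_mul prodFp_add.
Proof. by move=> x y z; apply: functional_extensionality_dep => p; exact: mulrDl. Qed.

HB.instance Definition _ := GRing.isZmodule.Build prodFp
  prodFp_addA prodFp_addC prodFp_add0 prodFp_addN.

Fact prodFp_oner_neq0 : prodFp_one != 0.
Proof.
apply/eqP => /(congr1 (fun f : prodFp => f (exist _ 2 isT))) /eqP.
by rewrite oner_eq0.
Qed.

HB.instance Definition _ := GRing.Zmodule_isComNzRing.Build prodFp
  prodFp_mulA prodFp_mulC prodFp_mul1 prodFp_mulDl prodFp_oner_neq0.

End ProdFpRing.

Definition directsum : prodFp -> bool :=
  fun x => `[< finite_set [set p : primeT | x p != 0] >].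

Lemma finite_primes_le (N : nat) : finite_set [set p : primeT | (val p <= N)%N].
Proof.
have -> : [set p : primeT | (val p <= N)%N] = val @^-1` `I_N.+1.
  by apply/seteqP; split=> p /=; rewrite ltnS.
by apply: finite_preimage (finite_II _) => p q _ _; exact: val_inj.
Qed.

Lemma infinite_primes : infinite_set [set: primeT].
Proof.
move=> /(finite_image (val : primeT -> nat)) /finite_seqP[s sE].
have [p pN pp] := prime_above (\sum_(i <- s) i)%N.
have : (val @` [set: primeT]) p by exists (exist _ p pp).
rewrite sE /= => ps; move: pN.
by rewrite (big_rem p) //= ltnNge leq_addr.
Qed.

Fact directsum_ideal : idealr_closed directsum.
Proof.
split.
- by apply/asboolP; apply: (sub_finite_set _ (finite_set0 _)) => p /eqP; apply.
- apply/asboolP => fin1; apply: infinite_primes.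
  apply: (sub_finite_set _ fin1) => p _.
  exact: (oner_neq0 'F_(val p)).
- move=> a x y /asboolP finx /asboolP finy; apply/asboolP.
  have : finite_set ([set p : primeT | x p != 0] `|` [set p : primeT | y p != 0]).
    by rewrite finite_setU.
  apply: sub_finite_set => p /=.
  have -> : (a * x + y) p = a p * x p + y p by [].
  have [->|?] := eqVneq (x p) 0; last by left.
  by rewrite mulr0 add0r; right.
Qed.

HB.instance Definition _ := isIdealr.Build prodFp directsum directsum_ideal.

Definition directsum_idealr : idealr prodFp := directsum.

Definition calA : comNzRingType := {ideal_quot directsum_idealr}.

Definition classA (x : prodFp) : calA := \pi_({ideal_quot directsum_idealr})%qT x.

Lemma classA_eq (x y : prodFp) :
  classA x = classA y <-> finite_set [set p : primeT | x p != y p].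
Proof.
have -> : [set p : primeT | x p != y p] = [set p : primeT | (x - y) p != 0].
  apply/seteqP; split=> p /=; have -> : (x - y) p = x p - y p by [];
  by rewrite subr_eq0.
split=> [/eqP|fin].
  by rewrite -Quotient.idealrBE => /asboolP.
by apply/eqP; rewrite -Quotient.idealrBE; apply/asboolP.
Qed.

Definition in_Zloc (p : nat) (r : rat) : bool := ~~ (p %| `|denq r|)%N.

Definition unit_Zloc (p : nat) (r : rat) : bool :=
  [&& r != 0, in_Zloc p r & in_Zloc p r^-1].

(* [ratr r] is [numq r / denq r] computed in 'F_p; on Z_(p) this is the
   reduction map Z_(p) -> Z/pZ, and outside Z_(p) the value is 0. *)
Definition redp (p : nat) (r : rat) : 'F_p := ratr r.

Lemma intr_Fp_eq0 (p : nat) (z : int) :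
  prime p -> (z%:~R == 0 :> 'F_p) = (p %| `|z|)%N.
Proof.
move=> pp; have cF := pchar_Fp pp.
case: z => n; first by rewrite -pmulrn (dvdn_pcharf cF).
by rewrite NegzE mulrNz oppr_eq0 -pmulrn (dvdn_pcharf cF) abszN.
Qed.

Lemma denq_frac_dvd (n d : int) : d != 0 ->
  (denq (n%:~R / d%:~R) %| d)%Z /\
  numq (n%:~R / d%:~R) * d = n * denq (n%:~R / d%:~R).
Proof.
move=> d0; set r : rat := n%:~R / d%:~R.
have E : numq r * d = n * denq r.
  apply: (@intr_inj rat); rewrite !intrM.
  apply/eqP; rewrite -eqr_div ?intr_eq0 ?denq_neq0 //.
  by rewrite divq_num_den.
split=> //; rewrite -(@Gauss_dvdzr (denq r) (numq r)).
  by rewrite E dvdz_mull.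
by rewrite /coprimez gcdzC; have := coprime_num_den r; rewrite /gcdz => /eqP ->.
Qed.

Section Reduction.

Variables (p : nat) (pp : prime p).

Lemma in_Zloc_frac (n d : int) : ~~ (p %| `|d|)%N -> in_Zloc p (n%:~R / d%:~R).
Proof.
move=> pd; have d0 : d != 0 by apply: contraNneq pd => ->; rewrite dvdn0.
have [dv _] := denq_frac_dvd n d0.
by apply: contra pd => /dvdn_trans; apply.
Qed.

Lemma redp_frac (n d : int) : ~~ (p %| `|d|)%N ->
  redp p (n%:~R / d%:~R) = n%:~R / d%:~R.
Proof.
move=> pd; have d0 : d != 0 by apply: contraNneq pd => ->; rewrite dvdn0.
have [_ E] := denq_frac_dvd n d0; have := in_Zloc_frac n pd.
rewrite /redp /ratr /in_Zloc; move: E; set r : rat := n%:~R / d%:~R => E pr.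
apply/eqP; rewrite eqr_div ?intr_Fp_eq0 //.
by rewrite -!intrM E.
Qed.

Lemma redpD (x y : rat) : in_Zloc p x -> in_Zloc p y ->
  redp p (x + y) = redp p x + redp p y.
Proof.
move=> px py; rewrite -[x in LHS]divq_num_den -[y in LHS]divq_num_den.
rewrite addf_div ?intr_eq0 ?denq_neq0 // -!rmorphM -rmorphD /= redp_frac.
  by rewrite rmorphD !rmorphM /= -addf_div ?intr_Fp_eq0.
by rewrite abszM Euclid_dvdM // negb_or; apply/andP.
Qed.

Lemma redpN (x : rat) : redp p (- x) = - redp p x.
Proof. by rewrite /redp /ratr numqN denqN rmorphN mulNr. Qed.

Lemma redpM (x y : rat) : in_Zloc p x -> in_Zloc p y ->
  redp p (x * y) = redp p x * redp p y.
Proof.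
move=> px py; rewrite -[x in LHS]divq_num_den -[y in LHS]divq_num_den.
rewrite mulf_div -!rmorphM /= redp_frac ?rmorphM /= -?mulf_div //.
by rewrite abszM Euclid_dvdM // negb_or; apply/andP.
Qed.

End Reduction.

(* The (finitely many) components where p divides the denominator are 0. *)
Definition ratA (r : rat) : calA :=
  classA (fun p : primeT => redp (val p) r).

Lemma finite_not_Zloc (r : rat) : finite_set [set p : primeT | ~~ in_Zloc (val p) r].
Proof.
apply: (sub_finite_set _ (finite_primes_le `|denq r|)) => p /=.
by rewrite negbK => /dvdn_leq; apply; rewrite absz_gt0 denq_neq0.
Qed.

Fact ratA_zmod_morphism : zmod_morphism ratA.
Proof.
move=> x y; rewrite /ratA /classA -rmorphB; apply/classA_eq.
have : finite_set ([set p : primeT | ~~ in_Zloc (val p) x] `|`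
                   [set p : primeT | ~~ in_Zloc (val p) y]).
  by rewrite finite_setU; split; exact: finite_not_Zloc.
apply: sub_finite_set => p /=.
have [px|] := boolP (in_Zloc (val p) x); last by left.
have [py|] := boolP (in_Zloc (val p) y); last by right.
rewrite redpD ?redpN ?(valP p) //; first by rewrite eqxx.
by rewrite /in_Zloc denqN.
Qed.

Fact ratA_monoid_morphism : monoid_morphism ratA.
Proof.
split.
  rewrite -[RHS](rmorph1 (\pi_({ideal_quot directsum_idealr})%qT)); apply/classA_eq.
  apply: (sub_finite_set _ (finite_set0 _)) => p /=.
  by rewrite /redp (ratr_nat _ 1) eqxx.
move=> x y; rewrite /ratA /classA -rmorphM; apply/classA_eq.
have : finite_set ([set p : primeT | ~~ in_Zloc (val p) x] `|`
                   [set p : primeT | ~~ in_Zloc (val p) y]).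
  by rewrite finite_setU; split; exact: finite_not_Zloc.
apply: sub_finite_set => p /=.
have [px|] := boolP (in_Zloc (val p) x); last by left.
have [py|] := boolP (in_Zloc (val p) y); last by right.
by rewrite redpM ?(valP p) // eqxx.
Qed.

HB.instance Definition _ := GRing.isZmodMorphism.Build rat calA ratA
  ratA_zmod_morphism.
HB.instance Definition _ := GRing.isMonoidMorphism.Build rat calA ratA
  ratA_monoid_morphism.

Lemma ratA_inj : injective ratA.
Proof. exact: fmorph_inj. Qed.

Definition fermat_quotient (p : nat) (a : rat) : rat :=
  (a ^+ p.-1 - 1) / p%:R.

Lemma in_Zloc_fermat_quotient (p : nat) (a : rat) :
  prime p -> unit_Zloc p a -> in_Zloc p (fermat_quotient p a).
Proof.
move=> pp /and3P[a0 pd pn].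
have {}pn : ~~ (p %| `|numq a|)%N.
  move: pn; rewrite /in_Zloc -[a in a^-1]divq_num_den invf_div.
  have n0 : numq a != 0 by rewrite numq_eq0.
  have [_ E] := denq_frac_dvd (denq a) n0.
  apply: contra => pn.
  have : (p %| `|(denq a * denq ((denq a)%:~R / (numq a)%:~R))%R|)%N.
    by rewrite -E abszM dvdn_mull.
  by rewrite abszM Euclid_dvdM // (negPf (pd : ~~ _)).
have fermat (z : int) : ~~ (p %| `|z|)%N -> z%:~R ^+ p.-1 = 1 :> 'F_p.
  rewrite -intr_Fp_eq0 // => z0; apply: (mulfI z0); rewrite mulr1 -exprS.
  rewrite prednK ?prime_gt0 //.
  by rewrite -(pFrobenius_autE (pchar_Fp pp)) rmorph_int.
have : (p %| `|(numq a ^+ p.-1 - denq a ^+ p.-1)%R|)%N.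
  by rewrite -intr_Fp_eq0 // rmorphB !rmorphXn /= !fermat ?subrr.
move=> dv; have /dvdzP[c cE] : (p%:Z %| numq a ^+ p.-1 - denq a ^+ p.-1)%Z by [].
have dq0 : (denq a)%:~R != 0 :> rat by rewrite intr_eq0 denq_neq0.
have p0 : p%:R != 0 :> rat by rewrite pnatr_eq0 -lt0n prime_gt0.
have -> : fermat_quotient p a = c%:~R / (denq a ^+ p.-1)%:~R.
  rewrite /fermat_quotient -[a in LHS]divq_num_den expr_div_n.
  have -> : (numq a)%:~R ^+ p.-1 = c%:~R * p%:R + (denq a)%:~R ^+ p.-1 :> rat.
    have := congr1 (intr : int -> rat) cE.
    rewrite intrB intrM !rmorphXn /= => <-.
    by rewrite subrK.
  rewrite rmorphXn /=; apply: (canLR (mulfK p0)).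
  by rewrite [(_ + _) / _]mulrDl divff ?expf_neq0 // addrK mulrAC.
apply: in_Zloc_frac => //; rewrite abszX Euclid_dvdX // negb_and.
by apply/orP; left; exact: pd.
Qed.

(* The (finitely many) components where a is not a unit of Z_(p) are 0; at the
   others [in_Zloc_fermat_quotient] makes the reduction meaningful. *)
Definition logA (a : rat) : calA :=
  classA (fun p : primeT =>
    if unit_Zloc (val p) a then redp (val p) (fermat_quotient (val p) a) else 0).

(* Main.v *)
(* Replacing alpha by its inverse and changing its sign where needed (this changes
   r at most by a sign), write alpha = a / c and r = s / t with a > |c| > 0 and
   s c > 0. For a large prime l let n = (a^l - c^l) / (a - c). Every prime p | n
   is 1 mod l, and the hypothesis on the Fermat quotient at p gives
     t (a^l - c^l) / p = - s l c^l  (mod p),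
   so n is squarefree. Summing over p | n, n divides the positive integer
     t (a - c) (sum of n / p for p | n) + s l c^l.
   But this integer is smaller than n: n has k prime factors, all larger than l,
   so l^k <= n <= (2a)^l makes k / l small, and l |c|^l is negligible against a^l. *)
Require Import Defs.
From mathcomp Require Import all_boot all_order all_algebra.
From mathcomp Require Import classical_sets cardinality.
From mathcomp Require Import ring zify.

Set Implicit Arguments.
Unset Strict Implicit.
Unset Printing Implicit Defensive.

Import Order.TTheory GRing.Theory Num.Theory.

Local Open Scope ring_scope.

(** * Counting and divisibility over the prime factors of [n] *)

Lemma exp_size_primes_leq (l n : nat) :
  (0 < n)%N -> (forall p, p \in primes n -> (l <= p)%N) ->
  (l ^ size (primes n) <= n)%N.
Proof.
move=> n_gt0 lP; rewrite {2}(prod_prime_decomp n_gt0) prime_decompE big_map /=.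
rewrite -[size _]count_predT -iter_muln_1 -big_const_seq.
rewrite big_seq [leqRHS]big_seq; apply: leq_prod => p pn.
apply: leq_trans (lP p pn) _; move: pn; rewrite mem_primes => /and3P[pp _ dp].
by rewrite -[leqLHS]expn1 leq_exp2l ?prime_gt1 // -pfactor_dvdn.
Qed.

Lemma sum_div_primes_leq (l n : nat) :
  (forall p, p \in primes n -> (l <= p)%N) ->
  (l * \sum_(p <- primes n) n %/ p <= size (primes n) * n)%N.
Proof.
move=> lP; rewrite big_distrr /= -[size _]count_predT mulnC -iter_addn_0 -big_const_seq.
rewrite big_seq [leqRHS]big_seq; apply: leq_sum => p pn.
by apply: leq_trans (leq_divM n p); rewrite mulnC leq_mul ?lP.
Qed.

(** If [q != p] is another prime factor, then [p * q] divides [n]. So modulo [p] the sum of all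
    [n %/ q] collapses to [n %/ p]. *)
Lemma dvdn_sum_div_other_primes (p n : nat) : p \in primes n ->
  (p %| \sum_(q <- primes n | q != p) n %/ q)%N.
Proof.
move=> pn; rewrite big_seq_cond; apply: dvdn_sum => q /andP[qn qp].
move: pn qn; rewrite !mem_primes => /and3P[pp _ dp] /and3P[pq _ dq].
rewrite dvdn_divRL // Gauss_dvd ?dp //.
by rewrite prime_coprime // dvdn_prime2 // eq_sym.
Qed.

Lemma dvdn_squarefree (n m : nat) : (0 < n)%N ->
  (forall p, p \in primes n -> ~~ (p ^ 2 %| n)%N) ->
  (forall p, p \in primes n -> (p %| m)%N) -> (n %| m)%N.
Proof.
move=> n_gt0 sqf pm; apply/dvdn_partP => // p; rewrite /= => pn.
rewrite p_part; apply: dvdn_trans (pm p pn).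
rewrite -[X in (_ %| X)%N]expn1; apply: dvdn_exp2l.
have := sqf p pn; rewrite pfactor_dvdn //; first by rewrite -ltnNge.
by move: pn; rewrite mem_primes => /andP[].
Qed.

(** * Size estimates *)

(** The binomial term ['C(l, 2) * c ^ (l - 2)] of [c.+1 ^ l] is quadratic in [l], hence outgrows
    [K * l * c ^ l]. *)
Lemma geometric_beats_linear (K a c l : nat) : (0 < c < a)%N ->
  (2 * K * c ^ 2 + 1 < l)%N -> (K * l * c ^ l < a ^ l)%N.
Proof.
move=> /andP[c0 ca] ltl.
have l2 : (2 <= l)%N by lia.
suff: (K * l * c ^ l < c.+1 ^ l)%N by move/leq_trans; apply; rewrite leq_exp2r //; lia.
have : ('C(l, 2) * c ^ (l - 2) <= c.+1 ^ l)%N.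
  rewrite -[c.+1]addn1 expnDn (bigD1 (Ordinal (l2 : 2 < l.+1)%N)) //= exp1n muln1.
  exact: leq_addr.
have := bin_ffact l 2; rewrite ffactnS ffactn1 => binE.
have -> : (c ^ l = c ^ 2 * c ^ (l - 2))%N by rewrite -expnD subnKC.
have : (0 < c ^ (l - 2))%N by rewrite expn_gt0 c0.
move: (c ^ (l - 2))%N (c.+1 ^ l)%N => X Y X0 XY.
have : ('C(l, 2) * 2 * X <= 2 * Y)%N by rewrite mulnAC mulnC leq_mul2l.
rewrite binE => XY2.
suff : (2 * (K * l * (c ^ 2 * X)) < l * l.-1 * X)%N by lia.
have -> : (2 * (K * l * (c ^ 2 * X)) = 2 * K * c ^ 2 * (l * X))%N by lia.
have -> : (l * l.-1 * X = l.-1 * (l * X))%N by lia.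
by rewrite ltn_mul2r muln_gt0 X0 /=; lia.
Qed.

(** Each summand is below half of [n]. Here [c] stands for an absolute value, so [D * n] is only
    known up to [c ^ l]; [k] counts the prime factors of [n], and [X] is the sum of the [n %/ p]. *)
Lemma error_term_ltn (a c D s t l n k X : nat) :
  (0 < c < a)%N -> (0 < D)%N ->
  (2 * (2 * D * s + 1) * c ^ 2 + 1 < l)%N -> ((2 * a) ^ (2 * t * D) < l)%N ->
  (D * n <= a ^ l + c ^ l)%N -> (a ^ l <= D * n + c ^ l)%N ->
  (l ^ k <= n)%N -> (l * X <= k * n)%N ->
  (t * D * X + s * l * c ^ l < n)%N.
Proof.
move=> /[dup] ca0 /andP[c0 ca] D0 lK la Dn_le le_Dn lk lX.
have l1 : (1 < l)%N by lia.
have cl0 : (0 < c ^ l)%N by rewrite expn_gt0 c0.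
have cal : (c ^ l <= a ^ l)%N by rewrite leq_exp2r; lia.
(* The [+ 1] in [2 * D * s + 1] pays for the gap [c ^ l] between [a ^ l] and [D * n]. *)
have large : (2 * (s * l * c ^ l) < n)%N.
  have := geometric_beats_linear ca0 lK.
  have : (c ^ l <= l * c ^ l)%N by rewrite leq_pmull //; lia.
  move=> h1 h2; rewrite -(ltn_pmul2l D0).
  have : ((2 * D * s + 1) * l * c ^ l = D * (2 * (s * l * c ^ l)) + l * c ^ l)%N by lia.
  lia.
have n_le : (n <= (2 * a) ^ l)%N.
  have : (n <= D * n)%N by rewrite leq_pmull.
  have : (2 * a ^ l <= (2 * a) ^ l)%N.
    by rewrite expnMn leq_mul // -[leqLHS]expn1 leq_exp2l // ltnW.
  lia.
(* Otherwise [l ^ l <= n ^ (2 * t * D)], and [n <= (2 * a) ^ l] would give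
   [l <= (2 * a) ^ (2 * t * D)]. *)
have few : (2 * t * D * k < l)%N.
  rewrite ltnNge; apply: contraL la => le_l; rewrite -leqNgt.
  rewrite -(@leq_exp2r _ _ l); last by lia.
  apply: leq_trans (_ : l ^ (2 * t * D * k) <= _)%N; first by rewrite leq_exp2l.
  rewrite [(_ * k)%N]mulnC expnM [leqRHS]expnAC.
  by case: (2 * t * D)%N => [|m] //; rewrite leq_exp2r // (leq_trans lk).
have n0 : (0 < n)%N by lia.
rewrite -(@ltn_pmul2l (2 * l)); last by lia.
have : (2 * t * D * (l * X) <= 2 * t * D * (k * n))%N by rewrite leq_mul2l lX orbT.
have : (2 * t * D * k * n < l * n)%N by rewrite ltn_mul2r n0.
have : (l * (2 * (s * l * c ^ l)) < l * n)%N by rewrite ltn_mul2l large; lia.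
by move: (c ^ l)%N => Y; nia.
Qed.

(** * Primes dividing [a ^+ l - c ^+ l] *)

Lemma fermat_Fp (p : nat) (z : int) : prime p -> ~~ (p %| `|z|)%N ->
  z%:~R ^+ p.-1 = 1 :> 'F_p.
Proof.
move=> pp; rewrite -intr_Fp_eq0 // => z0; apply: (mulfI z0).
rewrite mulr1 -exprS prednK ?prime_gt0 //.
by rewrite -(pFrobenius_autE (pchar_Fp pp)) rmorph_int.
Qed.

(** The order of [a / c] in ['F_p] divides the prime [l] and is not 1, so it is [l]; Fermat's little
    theorem concludes. *)
Lemma prime_exponent_dvd_pred (p l : nat) (a c : int) : prime p -> prime l ->
  ~~ (p %| `|c|)%N -> ~~ (p %| `|(a - c)%R|)%N -> (p %| `|(a ^+ l - c ^+ l)%R|)%N ->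
  (l %| p.-1)%N.
Proof.
move=> pp pl pc; rewrite -!intr_Fp_eq0 // !rmorphB /= !subr_eq0 !rmorphXn /=.
move=> ac acl; have c0 : c%:~R != 0 :> 'F_p by rewrite intr_Fp_eq0.
have u1 : (a%:~R / c%:~R) ^+ l = 1 :> 'F_p.
  by rewrite expr_div_n (eqP acl) divff // expf_neq0.
have [m prim ml] := prim_order_exists (prime_gt0 pl) u1.
have mE : m = l.
  case/primeP: pl => _ /(_ m ml) /orP[/eqP m1|/eqP //].
  move: (prim_expr_order prim); rewrite m1 expr1 => /(canRL (mulfVK c0)).
  by rewrite mul1r => /eqP; rewrite (negPf ac).
rewrite -mE (prim_order_dvd prim) expr_div_n !fermat_Fp ?divr1 //.
rewrite -intr_Fp_eq0 //; apply: contraNneq c0 => a0.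
by move: acl; rewrite a0 expr0n (gtn_eqF (prime_gt0 pl)) eq_sym expf_eq0 => /andP[].
Qed.

(* With p - 1 = l m, a^(p-1) - c^(p-1) = m c^(l(m-1)) p x  (mod p^2); multiply by
   l c^l and use l m = -1 and c^(p-1) = 1  (mod p). *)
Lemma fermat_quotient_transfer (p l : nat) (a c s t x : int) :
  prime p -> prime l ->
  ~~ (p %| `|c|)%N -> ~~ (p %| `|(a - c)%R|)%N -> a ^+ l - c ^+ l = p%:Z * x ->
  (p%:Z ^+ 2 %| t * (a ^+ p.-1 - c ^+ p.-1) - s * p%:Z)%Z ->
  (p %| `|(t * x + s * l%:Z * c ^+ l)%R|)%N.
Proof.
move=> pp pl pc pac acx.
have pacl : (p %| `|(a ^+ l - c ^+ l)%R|)%N by rewrite acx abszM dvdn_mulr.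
have /dvdnP[m pm] := prime_exponent_dvd_pred pp pl pc pac pacl.
have cF := fermat_Fp pp pc.
have aC : a%:~R ^+ l = c%:~R ^+ l :> 'F_p.
  apply/eqP; rewrite -subr_eq0 -!rmorphXn -rmorphB /=.
  by rewrite intr_Fp_eq0.
have m0 : (0 < m)%N by case: (m) pm; have := prime_gt1 pp; lia.
rewrite -intr_Fp_eq0 // pm [in a ^+ _]mulnC [in c ^+ _]mulnC !exprM subrXX acx.
set S := \sum_(i < m) _.
have SE : S%:~R = m%:R * (c%:~R ^+ l) ^+ m.-1 :> 'F_p.
  rewrite rmorph_sum /= mulr_natl -[m in RHS]card_ord -sumr_const.
  apply: eq_bigr => i _; rewrite rmorphM !rmorphXn /= aC -exprD subnK //.
    by rewrite card_ord.
  by rewrite -ltnS prednK.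
have -> : t * (p%:Z * x * S) - s * p%:Z = p%:Z * (t * x * S - s) by ring.
have p0 : p%:Z != 0 by have := prime_gt0 pp; lia.
rewrite expr2 dvdz_mul2l // => dvS.
have /eqP sE : s%:~R == t%:~R * x%:~R * (m%:R * (c%:~R ^+ l) ^+ m.-1) :> 'F_p.
  by rewrite -SE -!rmorphM eq_sym -subr_eq0 -rmorphB intr_Fp_eq0.
have lm : m%:R * l%:R = -1 :> 'F_p.
  rewrite -natrM -pm; apply/eqP; rewrite -subr_eq0 opprK natr1.
  by rewrite prednK ?prime_gt0 // pchar_Fp_0.
have Cm : c%:~R ^+ l * (c%:~R ^+ l) ^+ m.-1 = 1 :> 'F_p.
  by rewrite -exprS prednK // -exprM mulnC -pm.
rewrite rmorphD !rmorphM !rmorphXn /= sE -pmulrn.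
apply/eqP.
have cancel (F : comNzRingType) (T X C D M L : F) :
    M * L = -1 -> C * D = 1 -> T * X + T * X * (M * D) * L * C = 0.
  move=> ML CD; have -> : T * X + T * X * (M * D) * L * C =
    T * X * (1 + M * L * (C * D)) by ring.
  by rewrite ML CD; ring.
exact: cancel.
Qed.

Lemma prime_dvd_geometric_sum (p l : nat) (a c : int) :
  prime p -> prime l -> coprimez a c -> a != c -> (`|(a - c)%R| < l)%N ->
  (p %| `|(\sum_(i < l) a ^+ (l.-1 - i) * c ^+ i)%R|)%N ->
  [/\ ~~ (p %| `|c|)%N, ~~ (p %| `|(a - c)%R|)%N & (l < p)%N].
Proof.
move=> pp pl cop ac ltl pS; have l0 := prime_gt0 pl.
have pacl : (p %| `|(a ^+ l - c ^+ l)%R|)%N.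
  by rewrite subrXX abszM dvdn_mull.
have pc : ~~ (p %| `|c|)%N.
  apply/negP => pc; have pa : (p %| `|a|)%N.
    move: pacl pc; rewrite -!intr_Fp_eq0 // rmorphB !rmorphXn /= => acl /eqP c0.
    by move: acl; rewrite c0 expr0n (gtn_eqF l0) subr0 expf_eq0 => /andP[].
  have : (p %| gcdn `|a| `|c|)%N by rewrite dvdn_gcd pa.
  by move: cop; rewrite /coprimez /gcdz => /eqP[->]; rewrite Euclid_dvd1.
have pac : ~~ (p %| `|(a - c)%R|)%N.
  (* If [a = c] modulo [p], the sum is [l * c ^+ l.-1] modulo [p], so [p = l]; but [l] is too large
     to divide the nonzero [a - c]. *)
  apply/negP => pac; have pl' : p = l.
    apply/eqP; rewrite -dvdn_prime2 // -[l]/(`|l%:Z|%N) -intr_Fp_eq0 //.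
    have /eqP aE : a%:~R == c%:~R :> 'F_p.
      by rewrite -subr_eq0 -rmorphB intr_Fp_eq0.
    move: pS; rewrite -intr_Fp_eq0 // rmorph_sum /=.
    rewrite (eq_bigr (fun=> c%:~R ^+ l.-1)); last first.
      move=> i _; rewrite rmorphM !rmorphXn /= aE -exprD subnK //.
      by rewrite -ltnS prednK.
    rewrite sumr_const card_ord -mulr_natl mulf_eq0 expf_eq0 => /orP[//|].
    by rewrite (intr_Fp_eq0 c) // (negPf pc) andbF.
  move: ltl; rewrite -pl' ltnNge dvdn_leq // absz_gt0 subr_eq0 //.
split=> //; have := prime_exponent_dvd_pred pp pl pc pac pacl.
rewrite -(ltn_predK (prime_gt1 pp)) ltnS => /dvdn_leq; apply.
by rewrite -ltnS (ltn_predK (prime_gt1 pp)) prime_gt1.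
Qed.

(** * The contradiction over the integers *)

Lemma int_Fp_log_neq_rat (a c s t : int) (B : nat) :
  coprimez a c -> (`|c| < `|a|)%N -> 0 < a -> 0 < t -> 0 < s * c ->
  ~ (forall p, prime p -> (B < p)%N ->
       (p%:Z ^+ 2 %| t * (a ^+ p.-1 - c ^+ p.-1) - s * p%:Z)%Z).
Proof.
move=> cop ca a0 t0 sc H.
have c0 : c != 0 by apply: contraTneq sc => ->; rewrite mulr0 ltxx.
have s0 : s != 0 by apply: contraTneq sc => ->; rewrite mul0r ltxx.
have [D DE D0] : exists2 D : nat, a - c = D%:Z & (0 < D)%N.
  by exists `|(a - c)%R|%N; lia.
have [T tE T0] : exists2 T : nat, t = T%:Z & (0 < T)%N.
  by exists `|t|%N; lia.
have [A aE A0] : exists2 A : nat, a = A%:Z & (0 < A)%N.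
  by exists `|a|%N; lia.
pose K := (2 * (2 * D * `|s| + 1) * `|c| ^ 2 + 1)%N.
(* Primes [p > l] must exceed [B] and not divide [s]; [D] keeps [a - c] below [l], the 2 makes [l]
   odd, and the last two terms serve the size estimate. *)
have [l ll pl] := prime_above (B + D + `|s| + 2 + K + (2 * A) ^ (2 * T * D))%N.
have [lB lD ls lK] : [/\ B < l, D < l, `|s| < l & K < l]%N by split; lia.
have [l2 lA] : (2 < l)%N /\ ((2 * A) ^ (2 * T * D) < l)%N by lia.
have lodd : odd l by have [l2'|//] := even_prime pl; move: l2; rewrite l2'.
have clE : `|(c ^+ l)%R|%N = (`|c| ^ l)%N by rewrite abszX.
(* As [l] is odd, [s * c ^+ l] is [s * c] times a square: this is where the sign hypothesis
   enters. *)
have scl : s * c ^+ l = (`|s| * `|c| ^ l)%N%:Z.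
  rewrite -clE -abszM gez0_abs // -(odd_double_half l) lodd exprS mulrA.
  by rewrite mulr_ge0 ?(ltW sc) // -mul2n exprM exprn_ge0 ?sqr_ge0.
have ltcA : (`|c| ^ l < A ^ l)%N by rewrite ltn_exp2r; lia.
pose S := \sum_(i < l) a ^+ (l.-1 - i) * c ^+ i.
have aclE : a ^+ l - c ^+ l = D%:Z * S by rewrite subrXX DE.
have alE : a ^+ l = (A ^ l)%N%:Z by rewrite aE -!natz natrX.
have S0 : 0 < S.
  have : 0 < D%:Z * S by rewrite -aclE alE; lia.
  by rewrite pmulr_rgt0.
have [n SE n0] : exists2 n : nat, S = n%:Z & (0 < n)%N.
  by exists `|S|%N; lia.
have DnE : (D * n)%N%:Z = (A ^ l)%N%:Z - c ^+ l by rewrite PoszM -SE -aclE alE.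
have neq_ac : a != c by rewrite -subr_eq0 DE; lia.
have lt_acl : (`|(a - c)%R| < l)%N by rewrite DE.
have factor p : p \in primes n ->
    [/\ prime p, (l < p)%N, (p %| n)%N, ~~ (p %| `|c|)%N &
     (p %| T * (D * (n %/ p)) + `|s| * l * `|c| ^ l)%N].
  rewrite mem_primes => /and3P[pp _ pn].
  have pS : (p %| `|S|)%N by rewrite SE.
  have [pc pac lp] := prime_dvd_geometric_sum pp pl cop neq_ac lt_acl pS.
  split=> //.
  have xE : a ^+ l - c ^+ l = p%:Z * (D * (n %/ p))%N%:Z.
    by rewrite aclE SE -!PoszM -{1}(divnK pn) mulnA mulnC.
  have := fermat_quotient_transfer pp pl pc pac xE (H p pp (ltn_trans lB lp)).
  by rewrite mulrAC scl tE -!PoszM -PoszD /= [(_ * l)%N]mulnAC.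
have lP p : p \in primes n -> (l <= p)%N by case/factor => _ /ltnW.
pose X := (\sum_(p <- primes n) n %/ p)%N.
have : (T * D * X + `|s| * l * `|c| ^ l < n)%N.
  have [Dn_le le_Dn] : (D * n <= A ^ l + `|c| ^ l)%N /\ (A ^ l <= D * n + `|c| ^ l)%N.
    by rewrite -clE; move: (D * n)%N (A ^ l)%N (c ^+ l) DnE; clear; lia.
  have cA : (0 < `|c| < A)%N by rewrite absz_gt0 c0; move: ca; rewrite aE.
  exact: error_term_ltn cA D0 lK lA Dn_le le_Dn
    (exp_size_primes_leq n0 lP) (sum_div_primes_leq lP).
rewrite ltnNge => /negP; apply; apply: dvdn_leq.
  by rewrite addn_gt0 !muln_gt0 expn_gt0 !absz_gt0 c0 s0 (prime_gt0 pl) orbT.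
apply: dvdn_squarefree => // p pP; have [pp lp pn pc pE] := factor p pP.
  (* If [p ^ 2] divided [n], the first summand would vanish modulo [p], leaving [p] to divide
     [s * l * c ^ l], although [p] exceeds [l] and [|s|] and does not divide [c]. *)
  apply/negP; rewrite expnS expn1 -dvdn_divRL // => pnp.
  move: pE; rewrite dvdn_addr; last by rewrite !dvdn_mull.
  rewrite !Euclid_dvdM // Euclid_dvdX // (negPf pc) orbF.
  by rewrite !gtnNdvd ?absz_gt0 ?(ltn_trans ls) ?(prime_gt0 pl).
rewrite /X (bigD1_seq p) ?primes_uniq //= mulnDr -mulnA addnAC dvdn_add //.
by rewrite dvdn_mull // dvdn_sum_div_other_primes.
Qed.

(** For odd [p] the exponent [p.-1] is even, so [x] may be made positive and [y] given the sign of
    [s]. *)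
Lemma Fp_log_neq_rat (x y s t : int) (B : nat) :
  coprimez x y -> (`|y| < `|x|)%N -> y != 0 -> 0 < t -> s != 0 ->
  ~ (forall p, prime p -> (B < p)%N ->
       (p%:Z ^+ 2 %| t * (x ^+ p.-1 - y ^+ p.-1) - s * p%:Z)%Z).
Proof.
move=> cop ltyx y0 t0 s0 H.
(* The bound [B + 2] discards [p = 2], whose exponent 1 is odd. *)
apply: (@int_Fp_log_neq_rat `|x| (Num.sg s * `|y|) s t (B + 2)) => //.
- by rewrite /coprimez /gcdz abszM absz_sg s0 mul1n !absz_nat.
- by rewrite abszM absz_sg s0 mul1n !absz_nat.
- by rewrite normr_gt0 -absz_gt0; lia.
- by rewrite mulrA [s * _]mulrC -normrEsg mulr_gt0 ?normr_gt0.
move=> p pp pB.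
have [p2|oddp] := even_prime pp; first by lia.
have predE : p.-1 = (2 * p.-1./2)%N.
  by rewrite mul2n -[LHS]odd_double_half -subn1 oddB ?prime_gt0 //= oddp.
have sgE : (Num.sg s * `|y|) ^+ 2 = y ^+ 2.
  by rewrite exprMn sqr_sg s0 mul1r real_normK ?num_real.
rewrite predE !exprM sgE real_normK ?num_real // -!exprM -predE.
exact: H p pp (leq_ltn_trans (leq_addr _ _) pB).
Qed.

(** * From equality in [calA] to congruences modulo [p ^ 2] *)

Lemma finite_primes_bound (P : set primeT) : finite_set P ->
  exists B : nat, forall p, P p -> (val p <= B)%N.
Proof.
move=> /(finite_image (val : primeT -> nat)) /finite_seqP[r rE].
exists (\sum_(i <- r) i)%N => p Pp.
have : (val @` P)%classic (val p) by exists p.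
by rewrite rE /= => pr; rewrite (big_rem (val p)) //= leq_addr.
Qed.

(** The Fermat quotient is [f / d ^+ p.-1], whose denominator is 1 modulo [p]. *)
Lemma redp_fermat_quotient (p : nat) (n d f : int) : prime p ->
  ~~ (p %| `|d|)%N -> n ^+ p.-1 - d ^+ p.-1 = f * p%:Z ->
  redp p (fermat_quotient p (n%:~R / d%:~R)) = f%:~R.
Proof.
move=> pp pd fE.
have d0 : d%:~R != 0 :> rat.
  by rewrite intr_eq0; apply: contraNneq pd => ->; rewrite dvdn0.
have p0 : p%:R != 0 :> rat by rewrite pnatr_eq0 -lt0n prime_gt0.
have -> : fermat_quotient p (n%:~R / d%:~R) = f%:~R / (d ^+ p.-1)%:~R.
  rewrite /fermat_quotient expr_div_n -[X in _ - X](divff (expf_neq0 p.-1 d0)) -mulrBl.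
  rewrite -!rmorphXn -rmorphB /= fE rmorphM /=.
  by rewrite -[p%:~R]/(p%:R) mulrAC mulfK // mulrAC.
rewrite redp_frac //; first by rewrite rmorphXn /= fermat_Fp // divr1.
by rewrite abszX Euclid_dvdX // (negPf pd).
Qed.

Lemma logA_eq_ratA_dvd (alpha r : rat) : alpha != 0 -> logA alpha = ratA r ->
  exists B : nat, forall p, prime p -> (B < p)%N ->
    (p%:Z ^+ 2 %| denq r * (numq alpha ^+ p.-1 - denq alpha ^+ p.-1)
                  - numq r * p%:Z)%Z.
Proof.
move=> alpha0 /classA_eq /finite_primes_bound[B BP].
(* Beyond this bound [alpha] is a unit at [p] and [p] does not divide [denq r], so neither component
   is a default 0. *)
exists (B + `|numq alpha| + `|denq alpha| + `|denq r|)%N => p pp Bp.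
have ndvd (z : int) : z != 0 -> (`|z| < p)%N -> ~~ (p %| `|z|)%N.
  by move=> z0 zp; rewrite gtnNdvd ?absz_gt0.
have pd : ~~ (p %| `|denq alpha|)%N by rewrite ndvd ?denq_neq0 //; lia.
have pn : ~~ (p %| `|numq alpha|)%N by rewrite ndvd ?numq_eq0 //; lia.
have pt : ~~ (p %| `|denq r|)%N by rewrite ndvd ?denq_neq0 //; lia.
have unit_alpha : unit_Zloc p alpha.
  apply/and3P; split=> //.
  by rewrite -[alpha]divq_num_den invf_div; apply: in_Zloc_frac.
have : ~ (B >= p)%N by move: Bp; lia.
have := BP (exist _ p pp); rewrite /= unit_alpha => /contra_not /[apply] /negP.
rewrite negbK => redE.
have : (p%:Z %| numq alpha ^+ p.-1 - denq alpha ^+ p.-1)%Z.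
  rewrite -[X in is_true X]/(p %| _)%N -intr_Fp_eq0 // rmorphB !rmorphXn /=.
  by rewrite !fermat_Fp ?subrr.
case/dvdzP=> f fE; move: redE.
rewrite -{1}[alpha]divq_num_den (redp_fermat_quotient pp pd fE) /redp /ratr.
rewrite eq_sym -subr_eq0 => redE.
have -> : denq r * (numq alpha ^+ p.-1 - denq alpha ^+ p.-1) - numq r * p%:Z
   = p%:Z * (denq r * f - numq r) by rewrite fE; ring.
rewrite expr2 dvdz_mul2l; last by have := prime_gt0 pp; lia.
rewrite -[X in is_true X]/(p %| _)%N -intr_Fp_eq0 // rmorphB rmorphM /=.
move: redE; rewrite -(intr_Fp_eq0 _ pp) in pt.
rewrite -(mulIr_eq0 _ (mulIf pt)) mulrBl mulfVK // => /eqP E.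
by rewrite mulrC -oppr_eq0 opprB E.
Qed.

(** * Comparing the numerator and denominator of [alpha] *)

Theorem theorem8p1 (alpha : rat) (alpha_neq0 : alpha != 0)
    (alpha_neq1 : alpha != 1) (alpha_neqN1 : alpha != -1) :
  forall r : rat, r != 0 -> logA alpha <> ratA r.
Proof.
move=> r r0 /(logA_eq_ratA_dvd alpha_neq0)[B BP].
have s0 : numq r != 0 by rewrite numq_eq0.
have t0 := denq_gt0 r.
have cop : coprimez (numq alpha) (denq alpha) by exact: coprime_num_den.
have [lt|lt|E] := ltngtP `|numq alpha|%N `|denq alpha|%N.
(* Passing to the inverse of [alpha] negates the logarithm, hence [- numq r]. *)
- apply: (@Fp_log_neq_rat (denq alpha) (numq alpha) (- numq r) (denq r) B) => //.
  + by rewrite /coprimez gcdzC.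
  + by rewrite numq_eq0.
  + by rewrite oppr_eq0.
  move=> p pp Bp; have := BP p pp Bp; rewrite -rpredN.
  by congr (_ %| _)%Z; ring.
- by apply: Fp_log_neq_rat lt _ t0 s0 BP => //; exact: denq_neq0.
(* Coprime integers of equal absolute value are units, so [alpha] is 1 or -1. *)
have d1 : denq alpha = 1.
  move: cop; rewrite /coprimez /gcdz E gcdnn => /eqP[d1].
  by have := denq_gt0 alpha; lia.
have alphaE : alpha = (numq alpha)%:~R by rewrite -[LHS]divq_num_den d1 divr1.
move: alpha_neq1 alpha_neqN1; rewrite alphaE.
have [->|->] : numq alpha = 1 \/ numq alpha = -1 by move: E; rewrite d1; lia.
  by rewrite eqxx.
by rewrite rmorphN eqxx.
Qed.
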